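(* For integers $k \ge 1$ let $w(k) = \sum_{n=1}^{k} \arctan\left(\frac{1}{\sqrt{n}}\right)$, and let $v(k) := w((k+1)^2) - w(k^2)$ be the angle (in radians) on the Square Root Spiral between the successive square numbers $k^2$ and $(k+1)^2$. Then $$\lim_{k\to\infty} v(k) = 2,$$ which in degrees is $360^\circ/\pi$.
   Context: The Square Root Spiral (spiral of Theodorus) is built from right-angled triangles with a common vertex (the center): the $n$-th triangle ($n\ge 1$) has legs (cathets) of lengths $\sqrt n$ and $1$ and hypotenuse $\sqrt{n+1}$, the longer leg of each next triangle being the hypotenuse of the previous one. The angle of the $n$-th triangle at the center is $t_n = \arctan(1/\sqrt n)$, and $w(k) = \sum_{n=1}^k t_n$ is the cumulative angle of the first $k$ triangles. *)

(* Defs.v *)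
From Stdlib Require Import Reals.
From Coquelicot Require Import Coquelicot.

Open Scope R_scope.

(* [sum_n_m a 1 k] is the sum of [a n] over [1 <= n <= k], so [w 0 = 0]. *)
Definition w (k : nat) : R :=
  sum_n_m (fun n : nat => atan (1 / sqrt (INR n))) 1 k.

Definition v (k : nat) : R := w ((k + 1) ^ 2) - w (k ^ 2).

(* Main.v *)
Require Import Defs.
From Stdlib Require Import Reals Lra Lia.
From Coquelicot Require Import Coquelicot.

Open Scope R_scope.

(** Between two successive squares the spiral has exactly [2 k + 1] triangles,
    those with [k ^ 2 < n <= (k + 1) ^ 2], so [1 / sqrt n] lies between
    [1 / (k + 1)] and [1 / k].  Since [x / (1 + x ^ 2) <= atan x <= x] for
    [x > 0] (the mean value theorem, [atan_bounds]), each of their angles lies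
    between [1 / (k + 2)] and [1 / k] ([angle_bounds]).  Summing
    ([w_increment_bounds]), [v k] lies between [(2 k + 1) / (k + 2)] and
    [(2 k + 1) / k], so it is within [3 / k] of [2] ([v_bounds]). *)

Lemma atan_bounds (x : R) : 0 < x -> x / (1 + x ^ 2) <= atan x <= x.
Proof.
  intros Hx.
  destruct (MVT_cor2 atan (fun y => / (1 + y ^ 2)) 0 x Hx) as [c [Hc [Hc0 Hcx]]].
  { intros c _.
    replace (1 + c ^ 2) with (1 + Rsqr c) by (unfold Rsqr; ring).
    apply is_derive_Reals, is_derive_atan. }
  rewrite atan_0, !Rminus_0_r in Hc.
  rewrite Hc.
  assert (H1 : / (1 + x ^ 2) <= / (1 + c ^ 2)) by (apply Rinv_le_contravar; nra).
  assert (H2 : / (1 + c ^ 2) <= 1).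
  { rewrite <- Rinv_1. apply Rinv_le_contravar; nra. }
  unfold Rdiv.
  split; nra.
Qed.

(** The arctangent bound at [1 / s], with [s = sqrt n], is [1 / (s + 1 / s)];
    bounding [s] by [k + 1] and [1 / s] by [1] loses an amount of order
    [1 / k ^ 2] per angle, hence of order [1 / k] in the sum of [2 k + 1]
    angles, which vanishes in the limit. *)
Lemma angle_bounds (k n : nat) :
  (1 <= k)%nat -> (k ^ 2 < n <= (k + 1) ^ 2)%nat ->
  1 / (INR k + 2) <= atan (1 / sqrt (INR n)) <= 1 / INR k.
Proof.
  intros Hk [Hkn Hnk].
  assert (Hk1 : 1 <= INR k) by (apply (le_INR 1); exact Hk).
  apply lt_INR in Hkn.
  apply le_INR in Hnk.
  rewrite pow_INR in Hkn.
  rewrite pow_INR, plus_INR in Hnk; simpl (INR 1) in Hnk.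
  assert (Hlow : INR k <= sqrt (INR n)).
  { rewrite <- (sqrt_pow2 (INR k)) by lra. apply sqrt_le_1_alt; lra. }
  assert (Hup : sqrt (INR n) <= INR k + 1).
  { rewrite <- (sqrt_pow2 (INR k + 1)) by lra. apply sqrt_le_1_alt; lra. }
  set (s := sqrt (INR n)) in *.
  destruct (atan_bounds (1 / s)) as [Hl Hu].
  { apply Rdiv_lt_0_compat; lra. }
  split.
  - refine (Rle_trans _ _ _ _ Hl).
    replace (1 / s / (1 + (1 / s) ^ 2)) with (/ (s + / s)) by (field; nra).
    assert (/ s <= 1) by (rewrite <- Rinv_1; apply Rinv_le_contravar; lra).
    assert (0 < / s) by (apply Rinv_0_lt_compat; lra).
    unfold Rdiv; rewrite Rmult_1_l.
    apply Rinv_le_contravar; lra.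
  - refine (Rle_trans _ _ _ Hu _).
    unfold Rdiv; rewrite !Rmult_1_l.
    apply Rinv_le_contravar; lra.
Qed.

Lemma w_S (n : nat) : w (S n) = w n + atan (1 / sqrt (INR (S n))).
Proof. unfold w. rewrite sum_n_Sm by lia. reflexivity. Qed.

Lemma w_increment_bounds (a d : nat) (m M : R) :
  (forall n, (a < n <= a + d)%nat -> m <= atan (1 / sqrt (INR n)) <= M) ->
  INR d * m <= w (a + d) - w a <= INR d * M.
Proof.
  induction d as [|d IHd]; intros Hf.
  - rewrite Nat.add_0_r. simpl. lra.
  - rewrite Nat.add_succ_r, w_S, S_INR.
    assert (IH := IHd ltac:(intros n Hn; apply Hf; lia)).
    assert (Hlast := Hf (S (a + d)) ltac:(lia)).
    lra.
Qed.

Lemma v_bounds (k : nat) :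
  (1 <= k)%nat -> 2 - 3 / INR k <= v k <= 2 + 3 / INR k.
Proof.
  intros Hk.
  assert (Hk1 : 1 <= INR k) by (apply (le_INR 1); exact Hk).
  assert (Hsq : ((k + 1) ^ 2 = k ^ 2 + (2 * k + 1))%nat) by (simpl; lia).
  assert (Hv := w_increment_bounds (k ^ 2) (2 * k + 1)
                  (1 / (INR k + 2)) (1 / INR k)).
  rewrite <- Hsq in Hv.
  specialize (Hv (fun n => angle_bounds k n Hk)).
  fold (v k) in Hv.
  rewrite plus_INR, mult_INR in Hv; simpl (INR 1) in Hv; simpl (INR 2) in Hv.
  replace ((1 + 1) * INR k + 1) with (2 * INR k + 1) in Hv by ring.
  replace ((2 * INR k + 1) * (1 / (INR k + 2)))
    with (2 - 3 * / (INR k + 2)) in Hv by (field; lra).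
  replace ((2 * INR k + 1) * (1 / INR k))
    with (2 + / INR k) in Hv by (field; lra).
  assert (/ (INR k + 2) <= / INR k) by (apply Rinv_le_contravar; lra).
  assert (0 < / INR k) by (apply Rinv_0_lt_compat; lra).
  unfold Rdiv.
  lra.
Qed.

Theorem mainTheorem2 : is_lim_seq v 2 /\ toDeg 2 = 360 / PI.
Proof.
  split.
  - assert (H0 : is_lim_seq (fun k => 3 / INR k) 0).
    { replace (Finite 0) with (Rbar_mult 3 (Rbar_inv p_infty))
        by (simpl; f_equal; ring).
      apply (is_lim_seq_scal_l (fun k => / INR k)).
      apply is_lim_seq_inv; [exact is_lim_seq_INR | discriminate]. }
    apply (is_lim_seq_le_le_loc (fun k => 2 - 3 / INR k) v
             (fun k => 2 + 3 / INR k)).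
    + exists 1%nat. exact v_bounds.
    + replace (Finite 2) with (Finite (2 - 0)) by (f_equal; ring).
      apply is_lim_seq_minus'; [apply is_lim_seq_const | exact H0].
    + replace (Finite 2) with (Finite (2 + 0)) by (f_equal; ring).
      apply is_lim_seq_plus'; [apply is_lim_seq_const | exact H0].
  - unfold toDeg, plat.
    field.
    exact PI_neq0.
Qed.
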